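(* Let $(V,e)$ be a monotone complete absolute order unit space in which $OP(V)$ covers $V$, let $v \in V$, and let $\{e_{\alpha} : \alpha \in \mathbb{R}\}$ be the spectral resolution of $v$ in $OP(V)$. Then for any $\epsilon > 0$ and any finite increasing sequence $\alpha_0 < \dots < \alpha_n$ with $\alpha_0 < -\Vert v\Vert$, $\alpha_n > \Vert v\Vert$ and $\max\{\alpha_i - \alpha_{i-1} : 1 \le i \le n\} < \epsilon$, we have $$\Big\Vert v - \sum_{i=1}^n \alpha_i (e_{\alpha_i} - e_{\alpha_{i-1}}) \Big\Vert < \epsilon.$$
   Context: A real ordered vector space is a real vector space $V$ with a cone $V^+$ (closed under addition and multiplication by nonnegative reals); $v\le w$ means $w-v\in V^+$; $[v,w]=\{x: v\le x\le w\}$. An absolutely ordered space is a real ordered vector space with a map $|\cdot|:V\to V^+$ such that: (i) $|v|=v$ if $v\in V^+$; (ii) $|v|\pm v\in V^+$; (iii) $|kv|=|k||v|$ for $k\in\mathbb{R}$; (iv) if $|u-v|=u+v$ and $0\le w\le v$, then $|u-w|=u+w$; (v) if $|u-v|=u+v$ and $|u-w|=u+w$, then $\big|u-|v\pm w|\big|=u+|v\pm w|$. For $u,v\in V^+$, $u\perp v$ means $|u-v|=u+v$. For a norm on $V$ and $u,v\in V^+$, $u\perp_\infty v$ means $\Vert\alpha u+\beta v\Vert=\max(\Vert\alpha u\Vert,\Vert\beta v\Vert)$ for all $\alpha,\beta\in\mathbb{R}$; $u\perp_\infty^a v$ means $u_1\perp_\infty v_1$ whenever $0\le u_1\le u$,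 $0\le v_1\le v$. An absolute order unit space $(V,e)$ is an absolutely ordered space with $V^+$ proper and generating and an order unit $e$ (for each $v$ there is $k>0$ with $ke\pm v\in V^+$) such that $\Vert v\Vert=\inf\{k>0: ke\pm v\in V^+\}$ is a norm for which $V^+$ is closed, $u\le v\le w$ implies $\Vert v\Vert\le\max(\Vert u\Vert,\Vert w\Vert)$, and for $u,v\in V^+$: $u\perp v$ if and only if $u\perp_\infty^a v$. Order projections: $OP(V)=\{p\in[0,e]: p\perp(e-p)\}$; $p'=e-p$. For $u\in V^+$, $V_u=\{v\in V: ku\pm v\in V^+\text{ for some }k>0\}$. For $p\in OP(V)$, $AC(p)=V_p+V_{p'}$; every $v\in AC(p)$ has a unique decomposition $v=v_p+v_{p'}$ with $v_p\in V_p$, $v_{p'}\in V_{p'}$, and one writes $C_p(v)=v_p$, $C_p'(v)=v_{p'}$. $p\in OP(V)$ covers $v\in V$ if $v\in V_p$ and $V_p\subset V_q$ whenever $q\in OP(V)$ and $v\in V_q$. $OP(V)$ covers $V$ if every $v\in V$ has a cover in $OP(V)$, and $p_1\perp_\infty^a p_2$ whenever $p_i$ is the cover of $v_i\in V^+$ ($i=1,2$) and $v_1\perp_\infty^a v_2$. $V$ is monotone complete if every increasing net in $V$ that is bounded above has a supremum in $V$ (equivalently every decreasing net bounded below has an infimum). $\bigwedge$ denotes the greatest lower bound in $V$. The spectral resolution of $v$ in $OP(V)$ is the family $\{e_\alpha:\alpha\in\mathbb{R}\}\subset OP(V)$ satisfying: (1) it is increasing in $\alpha$; (2) $e_\alpha=0$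 if $\alpha<-\Vert v\Vert$ and $e_\alpha=e$ if $\alpha\ge\Vert v\Vert$; (3) $v\in AC(e_\alpha)$ for all $\alpha$; (4) $C_{e_\alpha}(v)\le\alpha e_\alpha$ and $C_{e_\alpha}'(v)\ge\alpha e_\alpha'$ for each $\alpha$; (5) for each $\alpha$, if $p\in OP(V)$, $v\in AC(p)$, $C_p(v)\le\alpha p$ and $C_p'(v)\ge\alpha p'$, then $p\le e_\alpha$; (6) $\bigwedge_{\alpha>\alpha_0}e_\alpha=e_{\alpha_0}$ for each $\alpha_0\in\mathbb{R}$. *)

(* Defs.v *)
From HB Require Import structures.
From mathcomp Require Import all_boot all_order all_algebra.
From mathcomp Require Import all_classical all_reals all_analysis.
Set Implicit Arguments.
Unset Strict Implicit.
Unset Printing Implicit Defensive.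
Import Order.TTheory GRing.Theory Num.Theory.
Import numFieldNormedType.Exports.
Local Open Scope classical_set_scope.
Local Open Scope ring_scope.

(** Orders induced by a cone [P]; no antisymmetry is assumed, so [P] is kept
    as an explicit set instead of using a [porderType] structure. *)

Definition cone_le (R : realType) (V : lmodType R) (P : set V) (x y : V) : Prop :=
  P (y - x).

Record is_cone (R : realType) (V : lmodType R) (P : set V) : Prop := IsCone {
  cone_add : forall x y : V, P x -> P y -> P (x + y);
  cone_scale : forall (k : R) (x : V), 0 <= k -> P x -> P (k *: x) }.

Definition is_proper (R : realType) (V : lmodType R) (P : set V) : Prop :=
  forall x : V, P x -> P (- x) -> x = 0.

Definition is_generating (R : realType) (V : lmodType R) (P : set V) : Prop :=
  forall v : V, exists u w : V, [/\ P u, P w & v = u - w].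

Definition abs_orth (R : realType) (V : lmodType R) (m : V -> V) (u v : V) : Prop :=
  m (u - v) = u + v.

Record is_absolutely_ordered (R : realType) (V : lmodType R)
    (P : set V) (m : V -> V) : Prop := IsAbsolutelyOrdered {
  abs_cone : is_cone P;
  abs_pos : forall v : V, P (m v);
  abs_id : forall v : V, P v -> m v = v;
  abs_bound : forall v : V, P (m v + v) /\ P (m v - v);
  abs_scale : forall (k : R) (v : V), m (k *: v) = `|k| *: m v;
  abs_orth_le : forall u v w : V, abs_orth m u v ->
    cone_le P 0 w -> cone_le P w v -> abs_orth m u w;
  abs_orth_abs : forall u v w : V, abs_orth m u v -> abs_orth m u w ->
    abs_orth m u (m (v + w)) /\ abs_orth m u (m (v - w)) }.

Definition inf_orth (R : realType) (V : normedModType R) (u v : V) : Prop :=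
  forall a b : R, `|a *: u + b *: v| = Num.max `|a *: u| `|b *: v|.

Definition abs_inf_orth (R : realType) (V : normedModType R) (P : set V)
    (u v : V) : Prop :=
  forall u1 v1 : V, cone_le P 0 u1 -> cone_le P u1 u ->
    cone_le P 0 v1 -> cone_le P v1 v -> inf_orth u1 v1.

(** The order unit norm is the norm of the underlying [normedModType], so that
    it being a norm is built in and [closed] refers to its topology. *)
Record is_absolute_order_unit (R : realType) (V : normedModType R)
    (P : set V) (m : V -> V) (e : V) : Prop := IsAbsoluteOrderUnit {
  aou_absolutely_ordered : is_absolutely_ordered P m;
  aou_proper : is_proper P;
  aou_generating : is_generating P;
  aou_order_unit : forall v : V,
    exists k : R, [/\ 0 < k, P (k *: e + v) & P (k *: e - v)];
  aou_norm : forall v : V,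
    `|v| = inf [set k : R | [/\ 0 < k, P (k *: e + v) & P (k *: e - v)]];
  aou_closed : closed P;
  aou_norm_le_max : forall u v w : V, cone_le P u v -> cone_le P v w ->
    `|v| <= Num.max `|u| `|w|;
  aou_orth : forall u v : V, P u -> P v ->
    (abs_orth m u v <-> abs_inf_orth P u v) }.

Structure absolute_order_unit_space (R : realType) := AbsoluteOrderUnitSpace {
  aou_sort :> normedModType R;
  pos : set aou_sort;
  absv : aou_sort -> aou_sort;
  ounit : aou_sort;
  aou_axioms : is_absolute_order_unit pos absv ounit }.

Definition vle (R : realType) (V : absolute_order_unit_space R) (x y : V) : Prop :=
  cone_le (@pos R V) x y.

Definition orth (R : realType) (V : absolute_order_unit_space R) (u v : V) : Prop :=
  abs_orth (@absv R V) u v.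

Definition orth_inf_a (R : realType) (V : absolute_order_unit_space R)
    (u v : V) : Prop :=
  abs_inf_orth (@pos R V) u v.

Definition is_sup (R : realType) (V : absolute_order_unit_space R)
    (A : set V) (s : V) : Prop :=
  (forall x : V, A x -> vle x s) /\
  (forall b : V, (forall x : V, A x -> vle x b) -> vle s b).

Definition is_inf (R : realType) (V : absolute_order_unit_space R)
    (A : set V) (s : V) : Prop :=
  (forall x : V, A x -> vle s x) /\
  (forall b : V, (forall x : V, A x -> vle b x) -> vle b s).

Record directed (D : Type) (leD : D -> D -> Prop) : Prop := Directed {
  directed_inhabited : inhabited D;
  directed_refl : forall i : D, leD i i;
  directed_trans : forall i j k : D, leD i j -> leD j k -> leD i k;
  directed_ub : forall i j : D, exists k : D, leD i k /\ leD j k }.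

Definition monotone_complete (R : realType) (V : absolute_order_unit_space R) : Prop :=
  forall (D : Type) (leD : D -> D -> Prop) (x : D -> V),
    directed leD ->
    (forall i j : D, leD i j -> vle (x i) (x j)) ->
    (exists b : V, forall i : D, vle (x i) b) ->
    exists s : V, is_sup (range x) s.

Definition OP (R : realType) (V : absolute_order_unit_space R) : set V :=
  [set p | [/\ vle 0 p, vle p (ounit V) & orth p (ounit V - p)]].

(** [compl p] is $p' = e - p$ and [ideal u] is $V_u$. *)
Definition compl (R : realType) (V : absolute_order_unit_space R) (p : V) : V :=
  ounit V - p.

Definition ideal (R : realType) (V : absolute_order_unit_space R) (u : V) : set V :=
  [set v | exists k : R, [/\ 0 < k, pos (k *: u + v) & pos (k *: u - v)]].

Definition AC (R : realType) (V : absolute_order_unit_space R) (p : V) : set V :=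
  [set v | exists a b : V, [/\ ideal p a, ideal (compl p) b & v = a + b]].

(** The components of [v \in AC p]; they are unique when [OP V p].
    Outside [AC p] both are the default value [0]. *)
Definition Cproj (R : realType) (V : absolute_order_unit_space R) (p v : V) : V :=
  xget 0 [set a | ideal p a /\ exists2 b : V, ideal (compl p) b & v = a + b].

Definition Cproj' (R : realType) (V : absolute_order_unit_space R) (p v : V) : V :=
  xget 0 [set b | ideal (compl p) b /\ exists2 a : V, ideal p a & v = a + b].

Definition covers (R : realType) (V : absolute_order_unit_space R) (p v : V) : Prop :=
  [/\ OP p, ideal p v &
    forall q : V, OP q -> ideal q v -> ideal p `<=` ideal q].

Definition OP_covers (R : realType) (V : absolute_order_unit_space R) : Prop :=
  (forall v : V, exists p : V, covers p v) /\
  (forall v1 v2 p1 p2 : V, pos v1 -> pos v2 -> covers p1 v1 -> covers p2 v2 ->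
    orth_inf_a v1 v2 -> orth_inf_a p1 p2).

Record spectral_resolution (R : realType) (V : absolute_order_unit_space R)
    (v : V) (E : R -> V) : Prop := SpectralResolution {
  sr_OP : forall a : R, OP (E a);
  sr_incr : forall a b : R, a <= b -> vle (E a) (E b);
  sr_0 : forall a : R, a < - `|v| -> E a = 0;
  sr_e : forall a : R, `|v| <= a -> E a = ounit V;
  sr_AC : forall a : R, AC (E a) v;
  sr_le : forall a : R, vle (Cproj (E a) v) (a *: E a);
  sr_ge : forall a : R, vle (a *: compl (E a)) (Cproj' (E a) v);
  sr_max : forall (a : R) (p : V), OP p -> AC p v ->
    vle (Cproj p v) (a *: p) -> vle (a *: compl p) (Cproj' p v) ->
    vle p (E a);
  sr_inf : forall a0 : R, is_inf [set E a | a in [set a | a0 < a]] (E a0) }.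

(* Main.v *)
Require Import Defs.
From mathcomp Require Import all_boot all_order all_algebra.
From mathcomp Require Import all_classical all_reals all_analysis.
Import Order.TTheory GRing.Theory Num.Theory.
Import numFieldNormedType.Exports.
Local Open Scope ring_scope.

(** For order projections [p <= q], with [p = E s] and [q = E t], the increment
    [w = C_q v - C_p v] satisfies [s (q - p) <= w <= t (q - p)]: the vector
    [t q - C_q v >= 0] has [t (q - p) - w] as its component in [V_p'], while
    [C_p' v - s p' >= 0] has [w - s (q - p)] as its component in [V_q], and
    components of positive vectors along an order projection are positive.
    Summing over the partition, the increments telescope to [v] and the
    differences [q - p] to [e], so the error lies in [[- d e, 0]], where
    [d < eps] is the mesh. *)

(** * Orthogonality and positivity of components in an absolutely ordered space *)

Section AbsolutelyOrdered.
Set Implicit Arguments.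
Unset Strict Implicit.
Context {R : realType} {V : lmodType R} {P : set V} {m : V -> V}.
Hypothesis hP : is_absolutely_ordered P m.
Implicit Types u v w x y : V.

Let PD x y : P x -> P y -> P (x + y).
Proof. exact: (cone_add (abs_cone hP)). Qed.

Lemma abs0 : m 0 = 0.
Proof. by rewrite -(scale0r 0) (abs_scale hP) normr0 !scale0r. Qed.

Lemma cone0 : P 0.
Proof. by rewrite -abs0; exact: (abs_pos hP). Qed.

Lemma abs_orth_sym u v : abs_orth m u v -> abs_orth m v u.
Proof.
rewrite /abs_orth => uv.
by rewrite -opprB -scaleN1r (abs_scale hP) normrN1 scale1r uv addrC.
Qed.

Lemma abs_orth_self u : abs_orth m u u -> u = 0.
Proof.
rewrite /abs_orth subrr abs0 => /esym/eqP.
by rewrite -mulr2n -scaler_nat scaler_eq0 pnatr_eq0 => /eqP.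
Qed.

Lemma abs_orthD u v w : P (v + w) ->
  abs_orth m u v -> abs_orth m u w -> abs_orth m u (v + w).
Proof.
by move=> Pvw uv uw; have [] := abs_orth_abs hP uv uw; rewrite (abs_id hP).
Qed.

Lemma abs_orth_natmul u v n : P u -> P v ->
  abs_orth m u v -> abs_orth m u (v *+ n).
Proof.
move=> Pu Pv uv.
(* Positivity is carried through the induction because [abs_orthD] asks for it. *)
suff [] : P (v *+ n) /\ abs_orth m u (v *+ n) by [].
elim: n => [|n [Pn IHn]].
  by rewrite /abs_orth mulr0n subr0 addr0 (abs_id hP) //; split=> //; exact: cone0.
have PS : P (v *+ n.+1) by rewrite mulrS; exact: PD.
by split=> //; rewrite mulrS; apply: abs_orthD => //; rewrite -mulrS.
Qed.

(** By the Archimedean property [k *: v] lies below an integer multiple of [v], and orthogonality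
    passes down to smaller positive elements. *)
Lemma abs_orthZ u v (k : R) : 0 <= k -> P u -> P v ->
  abs_orth m u v -> abs_orth m u (k *: v).
Proof.
move=> k0 Pu Pv /(abs_orth_natmul (Num.bound k) Pu Pv) uv.
have kb : k <= (Num.bound k)%:R by exact: ltW (archi_boundP k0).
apply: (abs_orth_le hP uv); rewrite /cone_le ?subr0.
  exact: (cone_scale (abs_cone hP)).
by rewrite -scaler_nat -scalerBl; apply: (cone_scale (abs_cone hP)) => //; rewrite subr_ge0.
Qed.

(* The order ideal of [u] is stable under [m] and orthogonal to whatever [u]
   is orthogonal to: write [2 x] as [(k u + x) - (k u - x)]. *)
Lemma abs_orth_ideal u w x (k : R) : 0 <= k -> P u -> P w ->
  abs_orth m w u -> P (k *: u + x) -> P (k *: u - x) -> abs_orth m w (m x).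
Proof.
move=> k0 Pu Pw wu Px Nx.
have w2k : abs_orth m w (k *: u + k *: u).
  by rewrite -scalerDl; apply: abs_orthZ => //; exact: addr_ge0.
have wpx : abs_orth m w (k *: u + x).
  by apply: (abs_orth_le hP w2k); rewrite /cone_le ?subr0 // opprD addrACA subrr add0r.
have wmx : abs_orth m w (k *: u - x).
  apply: (abs_orth_le hP w2k); rewrite /cone_le ?subr0 //.
  by rewrite opprD opprK addrACA subrr add0r.
have [_] := abs_orth_abs hP wpx wmx.
rewrite opprD opprK addrACA subrr add0r -mulr2n -scaler_nat (abs_scale hP) ger0_norm //.
move=> w2x; apply: (abs_orth_le hP w2x); rewrite /cone_le ?subr0.
  exact: (abs_pos hP).
by rewrite scaler_nat mulr2n addrK; exact: (abs_pos hP).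
Qed.

(** Split [x] as [xp - xn] with [xp], [xn] positive and orthogonal. Since [xn <= m x], it is also
    orthogonal to [p'], hence to [xp + l *: p']. That sum dominates [xn], as [x + y >= 0] and
    [y <= l *: p']; so [xn] is orthogonal to itself and vanishes. *)
Lemma component_pos p p' x y (k l : R) : P p -> P p' -> abs_orth m p p' ->
  0 <= k -> P (k *: p + x) -> P (k *: p - x) ->
  0 <= l -> P (l *: p' - y) -> P (x + y) -> P x.
Proof.
move=> Pp Pp' pp' k0 Px Nx l0 Ny Pxy.
have p'x := abs_orth_ideal k0 Pp Pp' (abs_orth_sym pp') Px Nx.
have [Pax Nax] := abs_bound hP x.
pose xp := 2%:R^-1 *: (m x + x); pose xn := 2%:R^-1 *: (m x - x).
have Pxp : P xp by apply: (cone_scale (abs_cone hP)).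
have Pxn : P xn by apply: (cone_scale (abs_cone hP)).
have half z : 2%:R^-1 *: (z + z) = z :> V.
  by rewrite -[z + z]mulr2n -[z *+ 2]scaler_nat scalerA mulVf ?scale1r // pnatr_eq0.
have xpDn : xp + xn = m x.
  by rewrite -scalerDr addrACA subrr addr0 half.
have xpBn : xp - xn = x.
  by rewrite -scalerBr opprB [m x + x]addrC addrACA [m x - m x]subrr addr0 half.
have np : abs_orth m xn xp.
  by apply: abs_orth_sym; rewrite /abs_orth xpBn xpDn.
have np' : abs_orth m xn (l *: p').
  apply: abs_orthZ => //; apply: abs_orth_sym.
  apply: (abs_orth_le hP p'x); rewrite /cone_le ?subr0 //.
  by rewrite -xpDn addrK.
have Plp' : P (l *: p') by exact: (cone_scale (abs_cone hP)).
have nn : abs_orth m xn xn.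
  apply: (abs_orth_le hP (abs_orthD (PD Pxp Plp') np np')).
    by rewrite /cone_le subr0.
  rewrite /cone_le; have -> : xp + l *: p' - xn = (x + y) + (l *: p' - y).
    by rewrite addrAC xpBn addrACA [y + - y]subrr addr0.
  exact: PD.
by rewrite -xpBn (abs_orth_self nn) subr0.
Qed.

End AbsolutelyOrdered.

(** * Order projections, their ideals and the components of a vector *)

Section OrderUnitSpace.
Set Implicit Arguments.
Unset Strict Implicit.
Context {R : realType} {V : absolute_order_unit_space R}.
Implicit Types p q u v x y : V.

Let hP := aou_absolutely_ordered (aou_axioms V).

Lemma posD x y : pos x -> pos y -> pos (x + y).
Proof. exact: (cone_add (abs_cone hP)). Qed.

Lemma posZ (k : R) x : 0 <= k -> pos x -> pos (k *: x).
Proof. exact: (cone_scale (abs_cone hP)). Qed.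

Lemma OP_pos p : OP p -> pos p.
Proof. by case; rewrite /vle /cone_le subr0. Qed.

Lemma OP_compl_pos p : OP p -> pos (compl p).
Proof. by case. Qed.

Lemma OP_component_pos p x y :
  OP p -> ideal p x -> ideal (compl p) y -> pos (x + y) -> pos x.
Proof.
move=> hp [k [k0 Px Nx]] [l [l0 Py Ny]]; have [_ _ pp'] := hp.
exact: (component_pos hP (OP_pos hp) (OP_compl_pos hp) pp' (ltW k0) Px Nx (ltW l0) Ny).
Qed.

Lemma OP_component_compl_pos p x y :
  OP p -> ideal p x -> ideal (compl p) y -> pos (x + y) -> pos y.
Proof.
move=> hp [k [k0 Px Nx]] [l [l0 Py Ny]]; have [_ _ pp'] := hp; rewrite addrC.
exact: (component_pos hP (OP_compl_pos hp) (OP_pos hp) (abs_orth_sym hP pp')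
  (ltW l0) Py Ny (ltW k0) Nx).
Qed.

Lemma idealN u x : ideal u x -> ideal u (- x).
Proof. by case=> k [k0 Px Nx]; exists k; split; rewrite ?opprK. Qed.

Lemma idealD u x y : ideal u x -> ideal u y -> ideal u (x + y).
Proof.
move=> [k [k0 Px Nx]] [l [l0 Py Ny]]; exists (k + l); split; first exact: addr_gt0.
  by rewrite scalerDl addrACA; exact: posD.
by rewrite scalerDl opprD addrACA; exact: posD.
Qed.

Lemma idealB u x y : ideal u x -> ideal u y -> ideal u (x - y).
Proof. by move=> ux uy; apply: idealD => //; exact: idealN. Qed.

Lemma ideal_sub u w x : vle u w -> ideal u x -> ideal w x.
Proof.
move=> uw [k [k0 Px Nx]]; exists k.
have kw : k *: w = k *: (w - u) + k *: u by rewrite -scalerDr subrK.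
by split=> //; rewrite kw -addrA; apply: posD => //; apply: posZ => //; exact: ltW.
Qed.

Lemma ideal_scale_le u x (c : R) : pos x -> vle x u -> ideal u (c *: x).
Proof.
move=> Px xu; have Pu : pos u by rewrite -(subrK x u); exact: posD.
(* The summand [1] keeps the constant strictly positive when [c = 0]. *)
exists (`|c| + 1); split; first by rewrite ltr_wpDl.
  have -> : (`|c| + 1) *: u + c *: x = u + `|c| *: (u - x) + (`|c| + c) *: x.
    by rewrite !scalerDl scale1r scalerBr [_ + u]addrC -!addrA addKr.
  apply: posD; last by apply: posZ => //; rewrite -lerBlDr sub0r -normrN ler_norm.
  by apply: posD => //; exact: posZ.
have -> : (`|c| + 1) *: u - c *: x = u + `|c| *: (u - x) + (`|c| - c) *: x.
  by rewrite !scalerDl scale1r scalerBr scaleNr [_ + u]addrC -!addrA addKr.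
apply: posD; last by apply: posZ => //; rewrite subr_ge0 ler_norm.
by apply: posD => //; exact: posZ.
Qed.

Lemma ideal0 x : ideal 0 x -> x = 0.
Proof.
case=> k [_]; rewrite scaler0 add0r sub0r.
exact: (aou_proper (aou_axioms V)).
Qed.

(** Positivity of components, applied to [x + (- x) = 0] and [(- x) + x = 0], makes both [x] and
    [- x] positive, and the cone is proper. *)
Lemma OP_disjoint p x : OP p -> ideal p x -> ideal (compl p) x -> x = 0.
Proof.
move=> hp px p'x; apply: (aou_proper (aou_axioms V)).
  by apply: (OP_component_pos (y := - x) hp px (idealN p'x)); rewrite subrr; exact: cone0 hP.
by apply: (OP_component_pos hp (idealN px) p'x); rewrite addNr; exact: cone0 hP.
Qed.

(** [Cproj] and [Cproj'] are chosen independently, each with its own partner. The two resulting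
    decompositions of [v] differ by an element of both ideals, which is zero, so the choices
    match. *)
Lemma CprojP p v : OP p -> Defs.AC p v ->
  [/\ ideal p (Cproj p v), ideal (compl p) (Cproj' p v) &
      v = Cproj p v + Cproj' p v].
Proof.
move=> hp [a [b [pa p'b vab]]].
have [pC [b1 p'b1 v1]] : ideal p (Cproj p v) /\
    exists2 b, ideal (compl p) b & v = Cproj p v + b.
  by rewrite /Cproj; case: xgetP => [? _ //|/(_ a)[]]; split=> //; exists b.
have [p'C [a1 pa1 v2]] : ideal (compl p) (Cproj' p v) /\
    exists2 a, ideal p a & v = a + Cproj' p v.
  by rewrite /Cproj'; case: xgetP => [? _ //|/(_ b)[]]; split=> //; exists a.
split=> //; rewrite {1}v2; congr (_ + _).
have E12 : a1 - Cproj p v = b1 - Cproj' p v.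
  by apply/eqP; rewrite subr_eq addrAC eq_sym subr_eq addrC -v1 -v2.
apply/eqP; rewrite -subr_eq0; apply/eqP; apply: (OP_disjoint hp).
  exact: idealB.
by rewrite E12; exact: idealB.
Qed.

Lemma norm_le_unit x (k : R) : 0 < k ->
  pos (k *: ounit V + x) -> pos (k *: ounit V - x) -> `|x| <= k.
Proof.
move=> k0 Px Nx; rewrite (aou_norm (aou_axioms V)); apply: ge_inf; last by split.
by exists 0 => ? [/ltW].
Qed.

(** * Bounds on the increment between two nested order projections *)

Section Increment.
Context {p q v : V} {s t : R}.
Hypotheses (hp : OP p) (hq : OP q) (pq : vle p q).
Hypotheses (vp : Defs.AC p v) (vq : Defs.AC q v).

(** In this form the increment is seen to lie in the ideal of [compl p], because
    [compl q <= compl p]. *)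
Let increment_compl : Cproj q v - Cproj p v = Cproj' p v - Cproj' q v.
Proof.
have [_ _ v1] := CprojP hp vp; have [_ _ v2] := CprojP hq vq.
by apply/eqP; rewrite subr_eq addrAC eq_sym subr_eq addrC -v1 -v2.
Qed.

Lemma increment_le : vle (Cproj q v) (t *: q) ->
  vle (Cproj q v - Cproj p v) (t *: (q - p)).
Proof.
move=> vtq.
have [pC p'C _] := CprojP hp vp; have [_ q'C _] := CprojP hq vq.
(* This [x] is the component along [p] of [t *: q - Cproj q v]. *)
apply: (OP_component_compl_pos (x := t *: p - Cproj p v) hp).
- apply: idealB => //; apply: ideal_scale_le; first exact: OP_pos.
  by rewrite /vle /cone_le subrr; exact: cone0 hP.
- apply: idealB.
    apply: ideal_scale_le => //.
    by rewrite /vle /cone_le opprB addrA subrK; exact: OP_compl_pos.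
  rewrite increment_compl; apply: idealB => //; apply: ideal_sub q'C.
  by rewrite /vle /cone_le /compl opprB [_ - p + _]addrC addrA subrK.
- by rewrite addrACA -scalerDr addrC [p + _]addrC subrK -opprD [Cproj p v + _]addrC subrK addrC.
Qed.

Lemma increment_ge : vle (s *: compl p) (Cproj' p v) ->
  vle (s *: (q - p)) (Cproj q v - Cproj p v).
Proof.
move=> vsp.
have [pC p'C _] := CprojP hp vp; have [qC q'C _] := CprojP hq vq.
(* With this [y] the two components add up to [Cproj' p v - s *: compl p]. *)
apply: (OP_component_pos (y := Cproj' q v - s *: compl q) hq).
- apply: idealB; first by apply: idealB => //; exact: ideal_sub pC.
  by apply: ideal_scale_le => //; rewrite /vle /cone_le opprB addrC subrK; exact: OP_pos.
- apply: idealB => //; apply: ideal_scale_le; first exact: OP_compl_pos.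
  by rewrite /vle /cone_le subrr; exact: cone0 hP.
- rewrite increment_compl addrACA subrK -opprD -scalerDr [q - p + _]addrC /compl.
  by rewrite addrA subrK.
Qed.

End Increment.

End OrderUnitSpace.

Theorem theorem7p12 (R : realType) (V : absolute_order_unit_space R)
    (hmc : monotone_complete V) (hcov : OP_covers V)
    (v : V) (E : R -> V) (hE : spectral_resolution v E)
    (eps : R) (heps : 0 < eps)
    (n : nat) (a : nat -> R)
    (ha : forall i : nat, (1 <= i <= n)%N -> a i.-1 < a i)
    (ha0 : a 0%N < - `|v|) (han : `|v| < a n)
    (hmesh : forall i : nat, (1 <= i <= n)%N -> a i - a i.-1 < eps) :
  `|v - \sum_(1 <= i < n.+1) a i *: (E (a i) - E (a i.-1))| < eps.
Proof.
(* The ends of the telescoping sum: at [a 0] the projection is [0], so its ideal is trivial; at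
   [a n] it is the unit, so the complementary ideal is trivial. *)
have C0 : Cproj (E (a 0%N)) v = 0.
  apply: ideal0; rewrite -{1}(sr_0 hE ha0).
  by have [] := CprojP (sr_OP hE (a 0%N)) (sr_AC hE (a 0%N)).
have Cn : Cproj (E (a n)) v = v.
  have [_] := CprojP (sr_OP hE (a n)) (sr_AC hE (a n)).
  rewrite {1}(sr_e hE (ltW han)) /compl subrr => /ideal0 -> {2}->.
  by rewrite addr0.
have telescope (f : R -> V) :
    \sum_(1 <= i < n.+1) (f (a i) - f (a i.-1)) = f (a n) - f (a 0%N).
  by rewrite big_add1 /= (telescope_sumr (fun i => f (a i))).
have vE : v = \sum_(1 <= i < n.+1) (Cproj (E (a i)) v - Cproj (E (a i.-1)) v).
  by rewrite (telescope (fun r => Cproj (E r) v)) C0 Cn subr0.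
have eE : ounit V = \sum_(1 <= i < n.+1) (E (a i) - E (a i.-1)).
  by rewrite telescope (sr_e hE (ltW han)) (sr_0 hE ha0) subr0.
have pos_sum (F : nat -> V) : (forall i, (1 <= i <= n)%N -> pos (F i)) ->
    pos (\sum_(1 <= i < n.+1) F i).
  move=> PF; rewrite big_nat; apply: big_ind => //.
  - exact: cone0 (aou_absolutely_ordered (aou_axioms V)).
  - exact: posD.
(* The default [eps / 2] makes [d] positive while staying below [eps]. Order bounds only yield a
   norm at most [d]; strictness comes from [d < eps]. *)
pose d := \big[Num.max/eps / 2]_(1 <= i < n.+1) (a i - a i.-1).
have d0 : 0 < d by apply: lt_le_trans (bigmax_ge_id _ _ _ _); rewrite divr_gt0.
have d_eps : d < eps.
  rewrite /d big_nat; apply: bigmax_lt => [|i /andP[i1 iN]].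
    by rewrite ltr_pdivrMr // mulr_natr mulr2n ltrDl.
  by apply: hmesh; rewrite i1.
have d_ge i : (1 <= i <= n)%N -> a i - a i.-1 <= d.
  by move=> hi; apply: (le_bigmax_seq _ _ xpredT (fun j => a j - a j.-1)) => //; rewrite mem_index_iota ltnS.
have incr i : (1 <= i <= n)%N -> vle (E (a i.-1)) (E (a i)).
  by move=> hi; apply: (sr_incr hE); exact: ltW (ha _ hi).
apply: le_lt_trans d_eps.
rewrite {1}vE -sumrB; apply: norm_le_unit => //; rewrite eE scaler_sumr.
- rewrite -big_split /=; apply: pos_sum => i hi.
  set D := E (a i) - _; set w := Cproj _ _ - _.
  (* The lower bound on [w] uses [a i.-1]; replacing it by [a i] costs at most [d *: D]. *)
  have -> : d *: D + (w - a i *: D) =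
      (w - a i.-1 *: D) + (d - (a i - a i.-1)) *: D.
    by rewrite -[RHS]addrA -!scaleNr [LHS]addrCA -!scalerDl opprB [- a i.-1 + _]addrCA addKr.
  apply: posD.
    exact: (increment_ge (sr_OP hE _) (sr_OP hE _) (incr i hi) (sr_AC hE _)
      (sr_AC hE _) (sr_ge hE _)).
  by apply: posZ; [rewrite subr_ge0; exact: d_ge | exact: incr].
(* On this side [a i] already bounds each increment, so the [d] term is mere slack. *)
- rewrite -sumrB; apply: pos_sum => i hi.
  rewrite opprB; apply: posD.
    by apply: posZ; [exact: ltW | exact: incr].
  exact: (increment_le (sr_OP hE _) (sr_OP hE _) (incr i hi) (sr_AC hE _)
      (sr_AC hE _) (sr_le hE _)).
Qed.
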